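(* Let $\{(\lambda_{i;j},u_{i;j})\}_{j\ge0}$ be the sequence generated by the PSD-id method for the $i$th eigenpair of $(H,S)$ with the shift-and-invert preconditioners $K_{i;j}=\widehat K_{i;j}=(H-\beta_{i;j}S)^{-1}$, where $$\beta_{i;j}=\lambda_{i;j}-c\,\|r_{i;j}\|_{S^{-1}},\qquad c=\inf_{k}\frac{\sqrt{(\lambda_{i;k}-\lambda_i)(\lambda_{i+1}-\lambda_{i;k})}}{\|r_{i;k}\|_{S^{-1}}}.$$ Let $\Delta_i=\dfrac{\lambda_i-\lambda_{i-1}}{\lambda_{i+1}-\lambda_i}$ and $\Delta_{i;j}=\dfrac{\lambda_{i;j}-\lambda_i}{\lambda_{i+1}-\lambda_{i;j}}$, and suppose that for all $j$ $$c>3\sqrt{\Delta_{i;j}}\qquad\text{and}\qquad 0<\Delta_{i;j}<\min\left\{\frac{\Delta_i^2}{4},\frac1{10}\right\}.$$ Then: (a) $\beta_{i;j}<\lambda_i$ and $\widehat K_{i;j}$ is effectively positive definite; (b) $\beta_{i;j}\to\lambda_i$ as $j\to\infty$; (c) $\lambda_{i;j}$ is localized, namely $\tau\big(\sqrt{\theta_{i;j}\epsilon_{i;j}}+\delta_{i;j}\epsilon_{i;j}\big)<1$; (d) $\Delta+\tau\sqrt{\theta_{i;j}\epsilon_{i;j}}\to0$ as $j\to\infty$. By (c) and (d), the preconditioner $\widehat K_{i;j}$ is asymptotically optimal.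
   Context: $H,S\in\mathbb{C}^{n\times n}$ are Hermitian and $S$ is positive definite. The eigenpairs of $Hu=\lambda Su$ are $(\lambda_k,u_k)$, $k=1,\dots,n$, with $\lambda_1\le\cdots\le\lambda_n$ and $U=[u_1\ \cdots\ u_n]$ satisfying $U^HSU=I$. Write $U_{i-1}=[u_1\ \cdots\ u_{i-1}]$ (empty if $i=1$) and $U_{i-1}^c=[u_i\ \cdots\ u_n]$. The index $i$ is fixed with $1\le i\le n-1$, and it is assumed that $\lambda_{i-1}<\lambda_i<\lambda_{i+1}$; when $i=1$, $\lambda_0$ denotes a fixed real number $\sigma<\lambda_1$. The Rayleigh quotient is $\rho(z)=z^HHz/(z^HSz)$; $\|x\|_S=\sqrt{x^HSx}$, $\|x\|_{S^{-1}}=\sqrt{x^HS^{-1}x}$; $\|\cdot\|$ is the spectral norm for matrices. PSD-id method (preconditioned steepest descent with implicit deflation): $U_{i-1}$ is known, and the initial vector $u_{i;0}$ satisfies $U_{i-1}^HSu_{i;0}=0$, $\|u_{i;0}\|_S=1$, with $\lambda_{i;0}=\rho(u_{i;0})$. For $j=0,1,2,\dots$: compute $r_{i;j}=Hu_{i;j}-\lambda_{i;j}Su_{i;j}$ and $p_{i;j}=-K_{i;j}r_{i;j}$ with preconditioner $K_{i;j}$; set $Z_j=[U_{i-1}\ u_{i;j}\ p_{i;j}]$ (assumed of full column rank) and let $(\gamma_i,w_i)$ be the $i$th eigenpair (eigenvalues in ascending order) of $(H_R,S_R)=(Z_j^HHZ_j,Z_j^HSZ_j)$ with $w_i^HS_Rw_i=1$;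 set $\lambda_{i;j+1}=\gamma_i$ and $u_{i;j+1}=Z_jw_i$. A preconditioner $K_{i;j}$ is effectively positive definite if $(U_{i-1}^c)^HSK_{i;j}SU_{i-1}^c$ is Hermitian positive definite. Notation for (c), (d), with $K_{i;j}=\widehat K_{i;j}$: $\epsilon_{i;j}=\lambda_{i;j}-\lambda_i$; $P_{i-1}=I-U_{i-1}U_{i-1}^HS$; $M=P_{i-1}^H(H-\lambda_iS)P_{i-1}$; $\theta_{i;j}=\|S^{1/2}K_{i;j}MK_{i;j}S^{1/2}\|$; $\delta_{i;j}=\|S^{1/2}K_{i;j}S^{1/2}\|$; $\Gamma$ and $\gamma$ are the largest and smallest positive eigenvalues of $K_{i;j}M$; $\Delta=(\Gamma-\gamma)/(\Gamma+\gamma)$ and $\tau=2/(\Gamma+\gamma)$ (these depend on $j$ through $K_{i;j}$). The preconditioner is called asymptotically optimal if $\lambda_{i;j}$ is localized (i.e. the inequality in (c) holds) and $\Delta+\tau\sqrt{\theta_{i;j}\epsilon_{i;j}}\to0$ as $j\to\infty$. *)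

(* Defs.v *)
From mathcomp Require Import all_boot all_order all_algebra.
From mathcomp Require Import sesquilinear spectral.
From mathcomp Require Import all_classical all_reals all_analysis.
From mathcomp Require Import complex.

Set Implicit Arguments.
Unset Strict Implicit.
Unset Printing Implicit Defensive.

Import Order.TTheory GRing.Theory Num.Theory.
Import numFieldNormedType.Exports.
Local Open Scope classical_set_scope.
Local Open Scope ring_scope.
Local Open Scope sesquilinear_scope.
Local Open Scope complex_scope.

(* Eigenvalues and eigenvectors are families indexed by [nat], numbered from 1;
   [A ^t*] is the conjugate transpose. *)

Definition posdefmx (R : realType) (n : nat) (A : 'M[R[i]]_n) : Prop :=
  A \is hermsymmx /\
  forall x : 'cV[R[i]]_n, x != 0 -> 0 < (x ^t* *m A *m x) 0 0.

(* The Hermitian form x^H A x, which is real when A is Hermitian. *)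
Definition qform (R : realType) (n : nat) (A : 'M[R[i]]_n) (x : 'cV[R[i]]_n) : R :=
  complex.Re ((x ^t* *m A *m x) 0 0).

Definition mxnormA (R : realType) (n : nat) (A : 'M[R[i]]_n) (x : 'cV[R[i]]_n) : R :=
  Num.sqrt (qform A x).

Definition norm2 (R : realType) (n : nat) (x : 'cV[R[i]]_n) : R :=
  mxnormA 1%:M x.

Definition rayleigh (R : realType) (n : nat) (H S : 'M[R[i]]_n)
    (z : 'cV[R[i]]_n) : R :=
  qform H z / qform S z.

Definition specnorm (R : realType) (n : nat) (A : 'M[R[i]]_n) : R :=
  sup [set t : R | exists2 x : 'cV[R[i]]_n, norm2 x <= 1 & t = norm2 (A *m x)].

(* Square root through the spectral decomposition A = Q^-1 diag(d) Q with Q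
   unitary; for A positive definite it is the positive definite square root. *)
Definition sqrtmx (R : realType) (n : nat) (A : 'M[R[i]]_n) : 'M[R[i]]_n :=
  invmx (spectralmx A) *m diag_mx (map_mx sqrtC (spectral_diag A))
    *m spectralmx A.

(* The n x m matrix [u_s  u_(s+1) ... u_(s+m-1)]. *)
Definition ucols (R : realType) (n : nat) (u : nat -> 'cV[R[i]]_n) (s m : nat) :
    'M[R[i]]_(n, m) :=
  \matrix_(a < n, k < m) u (s + k)%N a 0.

(* Ascending eigenvalues lam 1 <= ... <= lam n of the pencil (A, B), with
   B-orthonormal eigenvectors u 1, ..., u n. *)
Definition eigensystem (R : realType) (n : nat) (A B : 'M[R[i]]_n)
    (lam : nat -> R) (u : nat -> 'cV[R[i]]_n) : Prop :=
  [/\ forall k, (1 <= k <= n)%N -> A *m u k = (lam k)%:C *: (B *m u k),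
      forall k, (1 <= k < n)%N -> lam k <= lam k.+1
    & (ucols u 1 n) ^t* *m B *m ucols u 1 n = 1%:M].

(* (gam, w) is a k-th eigenpair of (A, B), normalized by w^H B w = 1. *)
Definition kth_eigenpair (R : realType) (n : nat) (A B : 'M[R[i]]_n) (k : nat)
    (gam : R) (w : 'cV[R[i]]_n) : Prop :=
  exists (mu : nat -> R) (v : nat -> 'cV[R[i]]_n),
    [/\ eigensystem A B mu v, (1 <= k <= n)%N, gam = mu k & w = v k].

Definition residual (R : realType) (n : nat) (H S : 'M[R[i]]_n)
    (l : R) (x : 'cV[R[i]]_n) : 'cV[R[i]]_n :=
  H *m x - l%:C *: (S *m x).

(* One iteration x |-> x', with l' the new Ritz value. [row_full Z] says that
   the rank of Z is its number of columns. *)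
Definition psdid_step (R : realType) (n : nat) (H S : 'M[R[i]]_n)
    (u : nat -> 'cV[R[i]]_n) (i : nat) (K : 'M[R[i]]_n)
    (l : R) (x : 'cV[R[i]]_n) (l' : R) (x' : 'cV[R[i]]_n) : Prop :=
  let p := - (K *m residual H S l x) in
  let Z := row_mx (row_mx (ucols u 1 i.-1) x) p in
  row_full Z /\
  exists w, kth_eigenpair (Z ^t* *m H *m Z) (Z ^t* *m S *m Z) i l' w
            /\ x' = Z *m w.

Definition psdid (R : realType) (n : nat) (H S : 'M[R[i]]_n)
    (u : nat -> 'cV[R[i]]_n) (i : nat) (K : nat -> 'M[R[i]]_n)
    (lamj : nat -> R) (uj : nat -> 'cV[R[i]]_n) : Prop :=
  [/\ (ucols u 1 i.-1) ^t* *m S *m uj 0%N = 0,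
      mxnormA S (uj 0%N) = 1,
      lamj 0%N = rayleigh H S (uj 0%N)
    & forall j, psdid_step H S u i (K j) (lamj j) (uj j) (lamj j.+1) (uj j.+1)].

(* (U_(i-1)^c)^H S K S U_(i-1)^c, with U_(i-1)^c = [u_i ... u_n], is Hermitian
   positive definite. *)
Definition effectively_posdef (R : realType) (n : nat) (S : 'M[R[i]]_n)
    (u : nat -> 'cV[R[i]]_n) (i : nat) (K : 'M[R[i]]_n) : Prop :=
  let Uc := ucols u i (n - i.-1) in
  posdefmx (Uc ^t* *m S *m K *m S *m Uc).

Definition deflproj (R : realType) (n : nat) (S : 'M[R[i]]_n)
    (u : nat -> 'cV[R[i]]_n) (i : nat) : 'M[R[i]]_n :=
  1%:M - ucols u 1 i.-1 *m (ucols u 1 i.-1) ^t* *m S.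

Definition deflM (R : realType) (n : nat) (H S : 'M[R[i]]_n)
    (lam : nat -> R) (u : nat -> 'cV[R[i]]_n) (i : nat) : 'M[R[i]]_n :=
  (deflproj S u i) ^t* *m (H - (lam i)%:C *: S) *m deflproj S u i.

Definition theta (R : realType) (n : nat) (S M K : 'M[R[i]]_n) : R :=
  specnorm (sqrtmx S *m K *m M *m K *m sqrtmx S).

Definition delta (R : realType) (n : nat) (S K : 'M[R[i]]_n) : R :=
  specnorm (sqrtmx S *m K *m sqrtmx S).

Definition pos_eigenvalues (R : realType) (n : nat) (A : 'M[R[i]]_n) : set R :=
  [set a : R | 0 < a /\ eigenvalue A a%:C].

(* [pos_eigenvalues (K *m M)] is finite, so that, when it is nonempty, its
   supremum and infimum are its largest and smallest elements. *)
Definition Gam_max (R : realType) (n : nat) (M K : 'M[R[i]]_n) : R :=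
  sup (pos_eigenvalues (K *m M)).

Definition gam_min (R : realType) (n : nat) (M K : 'M[R[i]]_n) : R :=
  inf (pos_eigenvalues (K *m M)).

Definition Delta (R : realType) (n : nat) (M K : 'M[R[i]]_n) : R :=
  (Gam_max M K - gam_min M K) / (Gam_max M K + gam_min M K).

Definition tau (R : realType) (n : nat) (M K : 'M[R[i]]_n) : R :=
  2 / (Gam_max M K + gam_min M K).

(* [eps] stands for the error lambda_(i;j) - lambda_i. *)
Definition localized (R : realType) (n : nat) (S M K : 'M[R[i]]_n) (eps : R) :
    Prop :=
  tau M K * (Num.sqrt (theta S M K * eps) + delta S K * eps) < 1.

Definition rate (R : realType) (n : nat) (S M K : 'M[R[i]]_n) (eps : R) : R :=
  Delta M K + tau M K * Num.sqrt (theta S M K * eps).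

Definition asymptotically_optimal (R : realType) (n : nat) (S M : 'M[R[i]]_n)
    (K : nat -> 'M[R[i]]_n) (eps : nat -> R) : Prop :=
  (forall j, localized S M (K j) (eps j)) /\
  (rate S M (K j) (eps j) @[j --> \oo] --> (0 : R)).

Definition resnorm (R : realType) (n : nat) (H S : 'M[R[i]]_n)
    (lamj : nat -> R) (uj : nat -> 'cV[R[i]]_n) (j : nat) : R :=
  mxnormA (invmx S) (residual H S (lamj j) (uj j)).

Definition shift_const (R : realType) (n : nat) (H S : 'M[R[i]]_n)
    (lam : nat -> R) (i : nat) (lamj : nat -> R) (uj : nat -> 'cV[R[i]]_n) : R :=
  inf (range (fun k : nat =>
    Num.sqrt ((lamj k - lam i) * (lam i.+1 - lamj k)) / resnorm H S lamj uj k)).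

Definition shift_invert (R : realType) (n : nat) (H S : 'M[R[i]]_n) (beta : R) :
    'M[R[i]]_n :=
  invmx (H - beta%:C *: S).

Definition gap_ratio (R : realType) (lam : nat -> R) (i : nat) : R :=
  (lam i - lam i.-1) / (lam i.+1 - lam i).

Definition err_ratio (R : realType) (lam : nat -> R) (i : nat) (l : R) : R :=
  (l - lam i) / (lam i.+1 - l).

(* Main.v *)
(** Write x = U y. In these coordinates S is the identity, H and the
    preconditioner K = U diag(1 / (lambda_k - beta)) U^H are diagonal, and the
    iterates have no component along u_1, ..., u_(i-1). Let
    e = lambda_(i;j) - lambda_i, G = lambda_(i+1) - lambda_i and
    b = lambda_i - beta. Temple's inequality ||r||^2 >= e (G - e) and the
    definition of c give 2 e < b <= sqrt (e (G - e)) - e, hence b < G / 4 and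
    beta stays closer to lambda_i than to lambda_(i-1). This yields
    tau <= (G + b) / G, theta <= 1 / (G + b) and delta <= 1 / b, which imply
    localization, and bounds the rate by 2 sqrt (e / G). Finally
    x + p = (lambda_(i;j) - beta) K S x is a step of inverse iteration;
    comparing the new Ritz value with its Rayleigh quotient by Courant-Fischer
    gives e' <= e / 20, so e tends to 0. *)

From HB Require Import structures.
Require Import Defs.
From mathcomp Require Import all_boot all_order all_algebra.
From mathcomp Require Import sesquilinear spectral.
From mathcomp Require Import all_classical all_reals all_analysis.
From mathcomp Require Import complex.
From mathcomp Require Import ring lra zify.

Set Implicit Arguments.
Unset Strict Implicit.
Unset Printing Implicit Defensive.

Import Order.TTheory GRing.Theory Num.Theory.
Import numFieldNormedType.Exports.
Local Open Scope classical_set_scope.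
Local Open Scope ring_scope.
Local Open Scope complex_scope.
Local Open Scope sesquilinear_scope.

(** * Squared moduli and real diagonal matrices *)

(** The squared modulus as an element of [R]; the norm of [R[i]] takes its values in [R[i]]. *)
Definition csq (R : realType) (z : R[i]) : R :=
  complex.Re z ^+ 2 + complex.Im z ^+ 2.

Lemma csqE (R : realType) (z : R[i]) : (csq z)%:C = z^*%R * z.
Proof. by rewrite /csq add_Re2_Im2 normCKC. Qed.

Lemma csq_ge0 (R : realType) (z : R[i]) : 0 <= csq z.
Proof. by rewrite addr_ge0 ?sqr_ge0. Qed.

Lemma csqM (R : realType) (z w : R[i]) : csq (z * w) = csq z * csq w.
Proof. by apply: complexI; rewrite rmorphM/= !csqE rmorphM /=; ring. Qed.

Lemma csqR (R : realType) (a : R) : csq a%:C = a ^+ 2.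
Proof. by rewrite /csq /= expr0n addr0. Qed.

Lemma csq_eq0 (R : realType) (z : R[i]) : (csq z == 0) = (z == 0).
Proof.
rewrite /csq paddr_eq0 ?sqr_ge0// !sqrf_eq0.
by rewrite eq_complex.
Qed.

Lemma csq_gt0 (R : realType) (z : R[i]) : (0 < csq z) = (z != 0).
Proof. by rewrite lt_def csq_ge0 andbT csq_eq0. Qed.

Lemma conjC_real (R : realType) (a : R) : (a%:C)^*%R = a%:C.
Proof. by apply: CrealP; apply/complex_realP; exists a. Qed.

Lemma trmxC_mul (R : realType) (m n p : nat) (A : 'M[R[i]]_(m, n))
    (B : 'M[R[i]]_(n, p)) : (A *m B) ^t* = B ^t* *m A ^t*.
Proof. by rewrite trmx_mul map_mxM. Qed.

Lemma hermsymmxP (R : realType) (n : nat) (A : 'M[R[i]]_n) :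
  reflect (A ^t* = A) (A \is hermsymmx).
Proof.
by rewrite is_hermitianmxE expr0 scale1r eq_sym; apply: eqP.
Qed.

Definition diagR (R : realType) (n : nat) (d : 'I_n -> R) : 'M[R[i]]_n :=
  diag_mx (\row_k (d k)%:C).

Lemma diagR_adj (R : realType) (n : nat) (d : 'I_n -> R) :
  (diagR d) ^t* = diagR d.
Proof.
rewrite /diagR tr_diag_mx map_diag_mx; congr diag_mx.
by apply/rowP => k; rewrite !mxE; exact: conjC_real.
Qed.

Lemma diagR_mul (R : realType) (n : nat) (d e : 'I_n -> R) :
  diagR d *m diagR e = diagR (fun k => d k * e k).
Proof.
rewrite /diagR mulmx_diag; congr diag_mx.
by apply/rowP => k; rewrite !mxE rmorphM.
Qed.

Lemma diagR1 (R : realType) (n : nat) (d : 'I_n -> R) :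
  (forall k, d k = 1) -> diagR d = 1%:M.
Proof.
by move=> d1; apply/matrixP => a b; rewrite !mxE d1 rmorph1.
Qed.

Lemma diagRB (R : realType) (n : nat) (d : 'I_n -> R) (b : R) :
  diagR d - (b%:C)%:M = diagR (fun k => d k - b).
Proof.
apply/matrixP => p q; rewrite !mxE.
by case: eqP => _; rewrite ?mulr1n ?mulr0n ?subr0// rmorphB.
Qed.

Lemma diagR_vec (R : realType) (n : nat) (d : 'I_n -> R) (x : 'cV[R[i]]_n) k :
  (diagR d *m x) k 0 = (d k)%:C * x k 0.
Proof. by rewrite /diagR mul_diag_mx !mxE. Qed.

Lemma diagR_quad (R : realType) (n : nat) (d : 'I_n -> R) (x : 'cV[R[i]]_n) :
  (x ^t* *m diagR d *m x) 0 0 = (\sum_k d k * csq (x k 0))%:C.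
Proof.
rewrite -mulmxA mxE rmorph_sum; apply: eq_bigr => k _.
by rewrite diagR_vec !mxE rmorphM/= csqE; ring.
Qed.

Lemma qform_diag (R : realType) (n : nat) (d : 'I_n -> R) (x : 'cV[R[i]]_n) :
  qform (diagR d) x = \sum_k d k * csq (x k 0).
Proof. by rewrite /qform diagR_quad. Qed.

Lemma qform_congr (R : realType) (m n : nat) (A : 'M[R[i]]_n)
    (X : 'M[R[i]]_(n, m)) (x : 'cV[R[i]]_m) :
  qform A (X *m x) = qform (X ^t* *m A *m X) x.
Proof. by rewrite /qform trmxC_mul !mulmxA. Qed.

Lemma qform1 (R : realType) (n : nat) (x : 'cV[R[i]]_n) :
  qform 1%:M x = \sum_k csq (x k 0).
Proof.
rewrite -(@diagR1 _ _ (fun=> 1))// qform_diag.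
by under eq_bigr do rewrite mul1r.
Qed.

(** V is square, hence unitary: V and V^H preserve the norm, and only the diagonal factor rescales
    coordinates. *)
Lemma specnorm_diag_le (R : realType) (n : nat) (V : 'M[R[i]]_n)
    (d : 'I_n -> R) (m : R) :
  V ^t* *m V = 1%:M -> (forall k, `|d k| <= m) -> 0 <= m ->
  specnorm (V *m diagR d *m V ^t*) <= m.
Proof.
move=> VV dm m0; apply: ge_sup.
  (* [ge_sup] asks for a nonempty set; the zero vector lies in the unit ball. *)
  exists (norm2 (V *m diagR d *m V ^t* *m (0 : 'cV_n))), 0 => //.
  by rewrite /norm2 /mxnormA qform1 big1 ?sqrtr0// => k _; rewrite mxE csqR expr0n.
move=> _ [x x1 ->].
have Vx (y : 'cV_n) : qform 1%:M (V *m y) = qform 1%:M y.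
  by rewrite qform_congr mulmx1 VV.
have VtV : V *m V ^t* = 1%:M by exact: mulmx1C.
have Vtx : qform 1%:M (V ^t* *m x) = qform 1%:M x.
  by rewrite -Vx mulmxA VtV mul1mx.
have q0 (y : 'cV_n) : 0 <= qform 1%:M y.
  by rewrite qform1; apply: sumr_ge0 => k _; exact: csq_ge0.
have {x1}x1 : qform 1%:M x <= 1.
  move: x1; rewrite /norm2 /mxnormA -{1}sqrtr1 ler_sqrt//.
rewrite /norm2 /mxnormA -[leRHS]ger0_norm// -sqrtr_sqr ler_wsqrtr//.
rewrite -!mulmxA Vx qform1.
rewrite (@le_trans _ _ (m ^+ 2 * qform 1%:M (V ^t* *m x)))//; last first.
  by rewrite Vtx ler_piMr ?sqr_ge0.
rewrite qform1 mulr_sumr ler_sum// => k _.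
rewrite diagR_vec csqM csqR ler_wpM2r ?csq_ge0//.
by rewrite -real_normK ?num_real// lerXn2r ?nnegrE ?normr_ge0.
Qed.

(** * Hermitian forms in the coordinates of an eigenbasis; Courant-Fischer *)

Section Pencil.
Context {R : realType} {n : nat} {A B : 'M[R[i]]_n}.
Context {lam : nat -> R} {u : nat -> 'cV[R[i]]_n}.
Hypothesis eig : eigensystem A B lam u.
Local Notation U := (ucols u 1 n).
Local Notation coord x k := ((U ^t* *m B *m x) k 0).

Lemma eig_orthonormal : U ^t* *m B *m U = 1%:M.
Proof. by case: eig. Qed.

Lemma eig_resolution : U *m (U ^t* *m B) = 1%:M.
Proof. exact: mulmx1C eig_orthonormal. Qed.

Lemma eig_mulmx : A *m U = B *m U *m diagR (fun k : 'I_n => lam k.+1).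
Proof.
case: eig => Au _ _; apply/matrixP => a k.
have -> : (A *m U) a k = (A *m u k.+1) a 0.
  by rewrite !mxE; apply: eq_bigr => b _; rewrite !mxE.
rewrite Au ?ltn_ord// mul_mx_diag !mxE mulrC; congr (_ * _).
by apply: eq_bigr => b _; rewrite !mxE.
Qed.

Lemma eig_diag : U ^t* *m A *m U = diagR (fun k : 'I_n => lam k.+1).
Proof. by rewrite -mulmxA eig_mulmx !mulmxA eig_orthonormal mul1mx. Qed.

Lemma eig_coordK (x : 'cV_n) : U *m (U ^t* *m B *m x) = x.
Proof. by rewrite mulmxA eig_resolution mul1mx. Qed.

Lemma eig_qformA (x : 'cV_n) : qform A x = \sum_(k < n) lam k.+1 * csq (coord x k).
Proof. by rewrite -{1}(eig_coordK x) qform_congr eig_diag qform_diag. Qed.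

Lemma eig_qformB (x : 'cV_n) : qform B x = \sum_(k < n) csq (coord x k).
Proof. by rewrite -{1}(eig_coordK x) qform_congr eig_orthonormal qform1. Qed.

Lemma eig_coord_neq0 (x : 'cV_n) : x != 0 -> exists k, coord x k != 0.
Proof.
move=> x0; apply/existsP; rewrite -negb_forall; apply: contra x0.
move=> /forallP c0; rewrite -(eig_coordK x).
suff -> : U ^t* *m B *m x = 0 by rewrite mulmx0.
by apply/colP => k; rewrite [RHS]mxE; apply/eqP.
Qed.

Lemma eig_qformB_gt0 (x : 'cV_n) : x != 0 -> 0 < qform B x.
Proof.
move=> /eig_coord_neq0[k ck]; rewrite eig_qformB (bigD1 k)//=.
rewrite ltr_wpDr ?csq_gt0//.
by apply: sumr_ge0 => ? _; exact: csq_ge0.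
Qed.

Lemma eig_coordE (x : 'cV_n) (k : 'I_n) : coord x k = ((u k.+1) ^t* *m B *m x) 0 0.
Proof.
rewrite -!mulmxA !mxE; apply: eq_bigr => a _.
by rewrite !mxE.
Qed.

Lemma eig_le (k m : nat) : (1 <= k <= m)%N -> (m <= n)%N -> lam k <= lam m.
Proof.
move=> /andP[k1]; elim: m => [|m IH]; first by case: k k1.
rewrite leq_eqVlt => /predU1P[-> //|km mn].
case: eig => _ mono _.
apply: le_trans (IH km (ltnW mn)) (mono m _).
by rewrite mn (leq_trans k1).
Qed.

Lemma eig_gram (j k : nat) : (1 <= j <= n)%N -> (1 <= k <= n)%N ->
  ((u j) ^t* *m B *m u k) 0 0 = (j == k)%:R.
Proof.
case: j k => [|j] [|k] //= jn kn.
have /matrixP/(_ (Ordinal jn) (Ordinal kn)) := eig_orthonormal.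
rewrite [RHS]mxE -val_eqE/= eqSS => <-.
rewrite !mxE; apply: eq_bigr => c _; rewrite !mxE; congr (_ * _).
by apply: eq_bigr => d _; rewrite !mxE.
Qed.

Lemma eig_qform_vec (k : nat) : (1 <= k <= n)%N ->
  qform B (u k) = 1 /\ qform A (u k) = lam k.
Proof.
move=> kn; have Bu : qform B (u k) = 1 by rewrite /qform eig_gram// eqxx.
split=> //; case: eig => /(_ k kn) Au _ _.
rewrite /qform -mulmxA Au -scalemxAr mulmxA mxE eig_gram// eqxx mulr1.
by [].
Qed.

(* A nonzero vector of the image of W is B-orthogonal to the first k-1
   eigenvectors; on it the form of A is at least lam k times that of B. *)
Lemma courant_fischer (k m : nat) (W : 'M[R[i]]_(n, m)) (rho : R) :
  (1 <= k <= m)%N ->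
  (forall a : 'cV_m, a != 0 -> W *m a != 0) ->
  (forall a : 'cV_m, qform A (W *m a) <= rho * qform B (W *m a)) ->
  lam k <= rho.
Proof.
move=> /andP[k1 km] Winj Wrho.
pose Q : 'M[R[i]]_(k.-1, m) := (ucols u 1 k.-1) ^t* *m B *m W.
(* Q has k - 1 rows and m >= k columns, so its kernel is nontrivial. *)
have [a a0 Qa] : exists2 a : 'cV_m, a != 0 & Q *m a = 0.
  have : kermx Q^T != 0.
    rewrite kermx_eq0 -row_leq_rank -ltnNge mxrank_tr.
    by rewrite (leq_ltn_trans (rank_leq_row _))// prednK.
  case/rowV0Pn => v /sub_kermxP vQ v0; exists v^T.
    by rewrite -trmx0 (inj_eq trmx_inj).
  by apply: trmx_inj; rewrite trmx_mul trmxK vQ trmx0.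
have y0 := Winj _ a0; have yr := Wrho a; set y := W *m a in y0 yr.
have cy (j : 'I_n) : (j < k.-1)%N -> coord y j = 0.
  move=> jk; rewrite eig_coordE; move/colP/(_ (Ordinal jk)): Qa.
  rewrite /Q -!mulmxA -/y [RHS]mxE => <-; rewrite !mxE.
  by apply: eq_bigr => b _; rewrite !mxE.
have := eig_qformB_gt0 y0; set q := qform B y in yr * => q0.
rewrite -(ler_pM2r q0); apply: le_trans yr.
rewrite eig_qformA /q eig_qformB mulr_sumr ler_sum// => j _.
have [/cy ->|jk] := ltnP j k.-1; first by rewrite csqR expr0n !mulr0.
rewrite ler_wpM2r ?csq_ge0// eig_le ?ltn_ord// k1/=.
by move: jk; case: (k) k1.
Qed.

End Pencil.

(** * The Hermitian square root of S *)

Section SquareRoot.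
Context {R : realType} {n : nat} {S : 'M[R[i]]_n}.
Hypothesis Spd : posdefmx S.

(** Testing the form of S on its eigenvectors gives the signs. Nonnegativity makes [sqrtC] of these
    entries real, so that [sqrtmx S] is Hermitian. *)
Lemma posdef_spectral : exists2 d : 'I_n -> R, (forall k, 0 <= d k) &
  spectral_diag S = \row_k (d k)%:C.
Proof.
case: Spd => Sh Sp.
have /orthomx_spectralP Sdec := hermitian_normalmx Sh.
have Pu := spectral_unitarymx S.
exists (fun k => complex.Re (spectral_diag S 0 k)) => [k|].
  pose x := (spectralmx S) ^t* *m delta_mx k (0 : 'I_1).
  have Px : spectralmx S *m x = delta_mx k 0.
    by rewrite /x mulmxA (unitarymxP Pu) mul1mx.
  have x0 : x != 0.
    apply: contraTneq isT => x0; move: Px; rewrite x0 mulmx0.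
    by move/matrixP/(_ k 0)/eqP; rewrite !mxE !eqxx eq_sym oner_eq0.
  have := ltW (Sp x x0); rewrite {1}Sdec invmx_unitary//.
  have -> : x ^t* *m ((spectralmx S) ^t* *m diag_mx (spectral_diag S) *m
      spectralmx S) *m x = (delta_mx k 0) ^t* *m diag_mx (spectral_diag S) *m
      delta_mx k 0.
    by rewrite -Px [in RHS]trmxC_mul !mulmxA.
  rewrite -mulmxA mxE (bigD1 k)//= big1 => [|j /negbTE jk]; last first.
    by rewrite !mxE jk conjC0 mul0r.
  rewrite addr0 mul_diag_mx !mxE !eqxx conjC1 mul1r mulr1.
  by rewrite lecE/= => /andP[].
apply/rowP => k; rewrite mxE RRe_real//.
have /mxOverP := hermitian_spectral_diag_real Sh.
exact.
Qed.

Lemma sqrtmx_adj : (sqrtmx S) ^t* = sqrtmx S.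
Proof.
have [d d0 dE] := posdef_spectral.
rewrite /sqrtmx invmx_unitary ?spectral_unitarymx// !trmxC_mul trmxCK mulmxA.
congr (_ *m _ *m _); rewrite tr_diag_mx map_diag_mx; congr diag_mx.
apply/rowP => k; rewrite !mxE dE mxE.
by apply: CrealP; rewrite ger0_real// sqrtC_ge0 lecR.
Qed.

Lemma sqrtmx_sq : sqrtmx S *m sqrtmx S = S.
Proof.
case: Spd => Sh _; have /orthomx_spectralP Sdec := hermitian_normalmx Sh.
rewrite [RHS]Sdec /sqrtmx !mulmxA mulmxK ?spectral_unit//.
congr (_ *m _); rewrite -mulmxA; congr (_ *m _); rewrite mulmx_diag.
by congr diag_mx; apply/rowP => k; rewrite !mxE -expr2 sqrtCK.
Qed.

End SquareRoot.

(* With S as intermediate factor the product of two such matrices is the one of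
   the product of the diagonals; the lock keeps [mulmxA] from splitting them. *)
HB.lock Definition udiag (R : realType) (n : nat) (v : nat -> 'cV[R[i]]_n)
    (d : 'I_n -> R) : 'M[R[i]]_n :=
  ucols v 1 n *m diagR d *m (ucols v 1 n) ^t*.

(** * Deflation and shift-and-invert as diagonal operators *)

Section ShiftInvert.
Context {R : realType} {n : nat} {H S : 'M[R[i]]_n}.
Context {lam : nat -> R} {u : nat -> 'cV[R[i]]_n}.
Hypothesis Spd : posdefmx S.
Hypothesis eig : eigensystem H S lam u.
Local Notation U := (ucols u 1 n).

Lemma adjS : S ^t* = S.
Proof. by case: Spd => /hermsymmxP. Qed.

Lemma udiag_mul (d e : 'I_n -> R) :
  udiag u d *m S *m udiag u e = udiag u (fun k => d k * e k).
Proof.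
rewrite udiag.unlock -diagR_mul -!mulmxA; congr (_ *m (_ *m _)).
by rewrite !mulmxA (eig_orthonormal eig) mul1mx.
Qed.

Lemma udiag_adj (d : 'I_n -> R) : (udiag u d) ^t* = udiag u d.
Proof. by rewrite udiag.unlock !trmxC_mul trmxCK diagR_adj mulmxA. Qed.

(** Here [udiag] is U U^H, which is the inverse of S because U^H (S U) = 1. *)
Lemma mul_S_udiag1 : S *m udiag u (fun=> 1) = 1%:M.
Proof.
rewrite udiag.unlock diagR1// mulmx1; rewrite mulmxA.
by apply: mulmx1C; rewrite mulmxA (eig_orthonormal eig).
Qed.

Lemma S_unit : S \in unitmx.
Proof. by have [] := mulmx1_unit mul_S_udiag1. Qed.

(** Combine H U = S U diag(lambda) with U U^H S = 1. *)
Lemma shifted_udiag (b : R) :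
  H - b%:C *: S = S *m udiag u (fun k => lam k.+1 - b) *m S.
Proof.
have -> : H - b%:C *: S = (H - b%:C *: S) *m (U *m (U ^t* *m S)).
  by rewrite (eig_resolution eig) mulmx1.
rewrite mulmxA mulmxBl (eig_mulmx eig) -scalemxAl udiag.unlock -diagRB.
rewrite mulmxBr [in RHS]mulmxBl [in RHS]mulmxBr !mulmxA mul_mx_scalar.
by rewrite !mulmxBl -!scalemxAl.
Qed.

Lemma shift_invert_udiag (b : R) : (forall k : 'I_n, lam k.+1 != b) ->
  shift_invert H S b = udiag u (fun k => (lam k.+1 - b)^-1).
Proof.
move=> nb; rewrite /shift_invert shifted_udiag.
set X := udiag u _; set Y := udiag u _.
have XY : S *m X *m S *m Y = 1%:M.
  rewrite -!mulmxA -mul_S_udiag1; congr (_ *m _).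
  rewrite (mulmxA X) udiag_mul; congr udiag.
  by apply/funext => k; rewrite mulfV ?subr_eq0.
have /mulmx1_unit[SXS _] := XY.
by rewrite -[RHS](mulKmx SXS) XY mulmx1.
Qed.

(** The ordinal k counts from 0 and stands for u_(k+1), so k < m selects u_1, ..., u_m. *)
Lemma ucols_adj_udiag (m : nat) : (m <= n)%N ->
  ucols u 1 m *m (ucols u 1 m) ^t* = udiag u (fun k => (k < m)%N%:R).
Proof.
move=> mn; apply/matrixP => a b; rewrite mxE.
under eq_bigr do rewrite !mxE.
rewrite (big_ord_widen n (fun k => u k.+1 a 0 * (u k.+1 b 0)^*%R))// big_mkcond.
rewrite udiag.unlock mxE; apply: eq_bigr => k _; rewrite mul_mx_diag !mxE.
by case: ifP => _; rewrite ?mulr1n ?mulr0n ?mulr1 ?mulr0 ?mul0r.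
Qed.

Lemma deflproj_udiag (i : nat) : (i <= n)%N ->
  deflproj S u i = udiag u (fun k => (i.-1 <= k)%N%:R) *m S.
Proof.
move=> ile; rewrite /deflproj ucols_adj_udiag ?(leq_trans (leq_pred _))//.
rewrite -[1%:M](mulmx1C mul_S_udiag1) -mulmxBl; congr (_ *m _).
rewrite udiag.unlock -mulmxBl -mulmxBr; congr (_ *m _ *m _).
apply/matrixP => a b; rewrite !mxE; case: eqP => _; rewrite ?mulr0n ?subr0//.
by rewrite !mulr1n -rmorphB/= ltnNge; case: leqP => _; rewrite ?subr0 ?subrr.
Qed.

Lemma deflM_udiag (i : nat) : (i <= n)%N -> deflM H S lam u i =
  S *m udiag u (fun k => (i.-1 <= k)%N%:R * (lam k.+1 - lam i)) *m S.
Proof.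
move=> ile; rewrite /deflM deflproj_udiag// shifted_udiag trmxC_mul adjS.
rewrite udiag_adj !mulmxA; congr (_ *m _).
rewrite -!(mulmxA S); congr (_ *m _); rewrite !udiag_mul; congr udiag.
by apply/funext => k; case: leqP; rewrite ?mul1r ?mulr1 ?mul0r.
Qed.

(** Conjugation by U turns [udiag u d *m S] into [diagR d]. As [eigenvalue] refers to row vectors, v
    is carried to v U. *)
Lemma eigenvalue_udiag (d : 'I_n -> R) (a : R) :
  eigenvalue (udiag u d *m S) a%:C -> exists k, a = d k.
Proof.
move=> /eigenvalueP[v va v0].
have w0 : v *m U != 0.
  apply: contra v0 => /eqP vU0; rewrite -[v]mulmx1 -(eig_resolution eig).
  by rewrite mulmxA vU0 mul0mx.
have vU : v *m U *m diagR d = a%:C *: (v *m U).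
  have := congr1 (mulmx^~ U) va; rewrite /= -scalemxAl => <-.
  by rewrite udiag.unlock -!mulmxA (mulmxA _ S) (eig_orthonormal eig) mulmx1.
have [k wk] := rV0Pn _ w0; exists k.
move/rowP/(_ k): vU; rewrite mul_mx_diag mxE [RHS]mxE mulrC.
by move=> /(mulIf wk); rewrite mxE => /complexI.
Qed.

Lemma udiag_eigenvalue (d : 'I_n -> R) (k : 'I_n) :
  eigenvalue (udiag u d *m S) (d k)%:C.
Proof.
pose e : 'rV[R[i]]_n := delta_mx 0 k.
apply/eigenvalueP; exists (e *m (U ^t* *m S)).
  have -> : e *m (U ^t* *m S) *m (udiag u d *m S) =
      e *m diagR d *m (U ^t* *m S).
    rewrite -mulmxA -[RHS]mulmxA udiag.unlock; congr (_ *m _).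
    by rewrite !mulmxA (eig_orthonormal eig) mul1mx.
  rewrite scalemxAl; congr (_ *m _).
  apply/rowP => j; rewrite mul_mx_diag !mxE.
  by case: (eqVneq j k) => [->|]; rewrite ?andbF ?mul0r ?mulr0 ?mulr1 ?mul1r.
apply/eqP => /(congr1 (mulmx^~ U))/=; rewrite mul0mx -mulmxA.
rewrite (eig_orthonormal eig) mulmx1 => /rowP/(_ k)/eqP.
by rewrite !mxE !eqxx oner_eq0.
Qed.

(** V = S^(1/2) U is unitary, since V^H V = U^H S U = 1. *)
Lemma specnorm_udiag_le (d : 'I_n -> R) (m : R) :
  (forall k, `|d k| <= m) -> 0 <= m ->
  specnorm (sqrtmx S *m udiag u d *m sqrtmx S) <= m.
Proof.
move=> dm m0; pose V := sqrtmx S *m U.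
have -> : sqrtmx S *m udiag u d *m sqrtmx S = V *m diagR d *m V ^t*.
  by rewrite udiag.unlock /V trmxC_mul (sqrtmx_adj Spd) !mulmxA.
apply: specnorm_diag_le => //.
rewrite /V trmxC_mul (sqrtmx_adj Spd) mulmxA -(mulmxA _ (sqrtmx S) (sqrtmx S)).
rewrite (sqrtmx_sq Spd).
exact: (eig_orthonormal eig).
Qed.

Lemma coord_udiag (d : 'I_n -> R) (x : 'cV[R[i]]_n) (k : 'I_n) :
  (U ^t* *m S *m (udiag u d *m S *m x)) k 0 =
  (d k)%:C * (U ^t* *m S *m x) k 0.
Proof.
by rewrite udiag.unlock !mulmxA (eig_orthonormal eig) mul1mx -!mulmxA diagR_vec.
Qed.

(** The residual is S y with y diagonal in x, and the S^(-1)-norm of S y is the S-norm of y. *)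
Lemma resnorm_sq (l : R) (x : 'cV[R[i]]_n) :
  qform (invmx S) (residual H S l x) =
  \sum_(k < n) (lam k.+1 - l) ^+ 2 * csq ((U ^t* *m S *m x) k 0).
Proof.
have -> : residual H S l x =
      S *m (udiag u (fun k => lam k.+1 - l) *m S *m x).
  by rewrite /residual scalemxAl -mulmxBl shifted_udiag !mulmxA.
rewrite qform_congr adjS mulmxV ?S_unit// mul1mx (eig_qformB eig).
by apply: eq_bigr => k _; rewrite coord_udiag csqM csqR.
Qed.

(** In eigenbasis coordinates, vectors in the range of U_(i-1)^c only meet the entries 1 / (lambda_k
    - b) with k >= i, which are positive. *)
Lemma shift_invert_effective (i : nat) (b : R) : (1 <= i <= n)%N ->
  (forall k : 'I_n, lam k.+1 != b) ->
  (forall k : 'I_n, (i.-1 <= k)%N -> b < lam k.+1) ->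
  effectively_posdef S u i (shift_invert H S b).
Proof.
move=> /andP[i1 ile] nb bl; rewrite /effectively_posdef shift_invert_udiag//.
set Uc := ucols u i _; set D := udiag u _.
split.
  by apply/hermsymmxP; rewrite !trmxC_mul trmxCK adjS udiag_adj !mulmxA.
move=> x x0; pose y := U ^t* *m S *m (Uc *m x).
have -> : x ^t* *m (Uc ^t* *m S *m D *m S *m Uc) *m x =
    y ^t* *m diagR (fun k : 'I_n => (lam k.+1 - b)^-1) *m y.
  by rewrite /y /D udiag.unlock !trmxC_mul trmxCK adjS !mulmxA.
rewrite diagR_quad ltcR.
(* y is x preceded by i - 1 zeros. *)
have yE (k : 'I_n) : y k 0 =
    \sum_(a < n - i.-1) (k == (i.-1 + a)%N :> nat)%:R * x a 0.
  rewrite /y mulmxA mxE; apply: eq_bigr => a _; congr (_ * _).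
  have an : (i.-1 + a < n)%N by rewrite -ltn_subRL.
  have := eig_orthonormal eig => /matrixP/(_ k (Ordinal an)).
  rewrite [RHS]mxE -val_eqE/= => <-; rewrite !mxE; apply: eq_bigr => c _.
  by rewrite !mxE /= addnA add1n prednK.
have y0 (k : 'I_n) : (k < i.-1)%N -> y k 0 = 0.
  move=> ki; rewrite yE big1// => a _; rewrite (_ : _ == _ = false) ?mul0r//.
  by apply/negbTE; rewrite neq_ltn (leq_trans ki)// leq_addr.
have Dk (k : 'I_n) : 0 <= (lam k.+1 - b)^-1 * csq (y k 0).
  have [/y0 ->|ik] := ltnP k i.-1; first by rewrite csqR expr0n mulr0.
  by rewrite mulr_ge0 ?csq_ge0// invr_ge0 subr_ge0 ltW ?bl.
have [a xa] : exists a, x a 0 != 0.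
  by case/matrix0Pn: x0 => a [j]; rewrite ord1; exists a.
have an : (i.-1 + a < n)%N by rewrite -ltn_subRL.
rewrite (bigD1 (Ordinal an))//= ltr_wpDr ?sumr_ge0//.
rewrite mulr_gt0 ?invr_gt0 ?subr_gt0 ?(bl (Ordinal an)) ?leq_addr// csq_gt0.
rewrite yE (bigD1 a)//= eqxx mul1r big1 ?addr0// => c ca.
by rewrite eqn_add2l eq_sym val_eqE (negbTE ca) mul0r.
Qed.

End ShiftInvert.

(** * One step of the method: deflation and the Ritz value *)

Section Step.
Context {R : realType} {n : nat} {H S : 'M[R[i]]_n}.
Context {lam : nat -> R} {u : nat -> 'cV[R[i]]_n}.
Hypothesis Spd : posdefmx S.
Hypothesis eig : eigensystem H S lam u.
Context {i : nat} {K : 'M[R[i]]_n} {l : R} {x : 'cV[R[i]]_n}.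
Context {l' : R} {x' : 'cV[R[i]]_n}.
Hypothesis i1n : (1 <= i <= n)%N.
Hypothesis step : psdid_step H S u i K l x l' x'.
Local Notation coord x k := (((ucols u 1 n) ^t* *m S *m x) k 0).

Lemma coord_ucols (m : nat) (a : 'cV[R[i]]_m) (k : 'I_n) :
  (m <= k)%N -> coord (ucols u 1 m *m a) k = 0.
Proof.
move=> mk; rewrite mulmxA mxE big1// => b _.
have bk : (b < k)%N by exact: leq_trans (ltn_ord b) mk.
have -> : ((ucols u 1 n) ^t* *m S *m ucols u 1 m) k b =
    ((u k.+1) ^t* *m S *m u b.+1) 0 0.
  rewrite !mxE; apply: eq_bigr => c _; rewrite !mxE; congr (_ * _).
  by apply: eq_bigr => d _; rewrite !mxE.
rewrite (eig_gram eig) ?ltn_ord//; last by rewrite (ltn_trans bk).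
by rewrite eqSS gtn_eqF// mul0r.
Qed.

Lemma psdid_step_normalized : qform S x' = 1 /\ qform H x' = l'.
Proof.
case: step => _ [w [[mu [v [eig' iN -> ->]]] ->]].
by rewrite !qform_congr; exact: (eig_qform_vec eig' iN).
Qed.

(** The Ritz pair is a Galerkin solution: Z^H (H x' - l' S x') = 0. The row of Z^H coming from
    u_(k+1) reads (lambda_(k+1) - l') times the coordinate of x', and the first factor is
    nonzero. *)
Lemma psdid_step_deflated (k : 'I_n) :
  (k < i.-1)%N -> lam k.+1 < l' -> coord x' k = 0.
Proof.
case: step => _ [w [[mu [v [eig' iN -> ->]]] ->]] ki ll'.
case: eig' => /(_ i iN) + _ _; set Z := row_mx _ _.
rewrite -!mulmxA; set y := Z *m v i.
have -> : Z ^t* = col_mx (col_mx ((ucols u 1 i.-1) ^t*) (x ^t*))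
    ((- (K *m residual H S l x)) ^t*).
  by rewrite /Z !tr_row_mx !map_col_mx.
rewrite !mul_col_mx !scale_col_mx => /eq_col_mx[/eq_col_mx[+ _] _].
move=> /colP/(_ (Ordinal ki)).
have rowE (X : 'cV[R[i]]_n) : ((ucols u 1 i.-1) ^t* *m X) (Ordinal ki) 0 =
    ((ucols u 1 n) ^t* *m X) k 0.
  by rewrite !mxE; apply: eq_bigr => c _; rewrite !mxE.
have HyE : (ucols u 1 n) ^t* *m (H *m y) =
    diagR (fun k : 'I_n => lam k.+1) *m ((ucols u 1 n) ^t* *m S *m y).
  by rewrite -{1}(eig_coordK eig y) !mulmxA (eig_diag eig).
rewrite [RHS]mxE !rowE HyE diagR_vec !mulmxA => /eqP.
rewrite -subr_eq0 -mulrBl mulf_eq0 -rmorphB/= => /orP[|/eqP//].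
by rewrite eq_complex/= eqxx andbT subr_eq0 lt_eqF.
Qed.

(** Courant-Fischer for the projected pencil on the i-dimensional space of coefficients of U_(i-1)
    and z = x + p. As z has no component along U_(i-1), the forms split over the two pieces. *)
Lemma psdid_step_le (rho : R) : lam i <= rho ->
  (forall k : 'I_n, (k < i.-1)%N -> coord (x - K *m residual H S l x) k = 0) ->
  qform H (x - K *m residual H S l x) <=
    rho * qform S (x - K *m residual H S l x) ->
  l' <= rho.
Proof.
case: step => _ [w [[mu [v [eig' iN -> _]]] _]] lr.
set z := x - _ => z0 zr.
have [i1 ile] := andP i1n.
(* W repeats the last coefficient, so Z W (a, t) = U_(i-1) a + t (x + p). *)
pose W : 'M[R[i]]_(i.-1 + 1 + 1, i.-1 + 1) :=
  col_mx 1%:M (row_mx 0 1%:M).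
apply: (courant_fischer eig' (W := W)).
- by rewrite addn1 prednK ?i1 ?leqnn.
- move=> a; apply: contra => /eqP/(congr1 usubmx).
  by rewrite mul_col_mx col_mxKu mul1mx linear0 => ->.
move=> a; rewrite -!qform_congr mulmxA mul_row_col mulmx1.
rewrite mul_mx_row mulmx0 mulmx1 add_row_mx addr0 -/z.
rewrite -[a]vsubmxK mul_row_col; set X := _ + _.
have cX (k : 'I_n) : (i.-1 <= k)%N -> coord X k = coord z k * dsubmx a 0 0.
  move=> ik; rewrite /X mulmxDr mxE coord_ucols// add0r mulmxA mxE big_ord1.
  by [].
(* Termwise: for k < i - 1 the left term is nonpositive since lambda_(k+1) <= lambda_i <= rho, and
   the right one is 0; for other k they agree. *)
rewrite (eig_qformA eig) (eig_qformB eig) -subr_le0 mulr_sumr -sumrB.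
apply: (@le_trans _ _ (\sum_(k < n)
    (lam k.+1 - rho) * (csq (coord z k) * csq (dsubmx a 0 0)))); last first.
  under eq_bigr do rewrite mulrA.
  rewrite -mulr_suml mulr_le0_ge0 ?csq_ge0//.
  rewrite -subr_le0 (eig_qformA eig) (eig_qformB eig) mulr_sumr -sumrB in zr.
  by move: zr; under eq_bigr do rewrite -mulrBl.
rewrite ler_sum// => k _; rewrite -mulrBl.
have [ki|/cX ->] := ltnP k i.-1; last by rewrite csqM.
rewrite z0// csqR expr0n mul0r mulr0 mulr_le0_ge0 ?csq_ge0//.
rewrite subr_le0 (le_trans _ lr)// (eig_le eig)//=.
by rewrite (leq_trans ki) ?leq_pred.
Qed.

End Step.

(** * Scalar estimates for the error and the shift *)

(** The sign of a' - l has to be derived: if it were 0 the quotient would be 0 by convention, and if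
    negative then l > a' > a would make the quotient negative. Then 10 (l - a) < a' - l gives the
    factor 11. *)
Lemma err_ratio_bounds (R : realType) (a a' l : R) : a < a' ->
  0 < (l - a) / (a' - l) < 1 / 10 -> 0 < l - a /\ 11 * (l - a) < a' - a.
Proof.
move=> aa' /andP[q0 q1].
have [f0|f0|f0] := ltgtP (a' - l) 0; last 1 first.
- by rewrite f0 invr0 mulr0 ltxx in q0.
- by move: q0; rewrite -(mulrNN _ _^-1) -invrN pmulr_lgt0 ?invr_gt0; lra.
have e0 : 0 < l - a by rewrite pmulr_lgt0 ?invr_gt0 in q0.
by split=> //; move: q1; rewrite ltr_pdivrMr//; lra.
Qed.

(* Here e is the error of the Ritz value, f its distance to the next
   eigenvalue and r the residual norm; e * f <= r ^+ 2 is Temple's inequality. *)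
Lemma shift_bounds (R : realType) (e f g c r : R) :
  0 < e -> 10 * e < f -> 0 < g -> 0 < r -> e * f <= r ^+ 2 ->
  c <= Num.sqrt (e * f) / r -> 3 * Num.sqrt (e / f) < c ->
  e / f < (g / (e + f)) ^+ 2 / 4 ->
  [/\ 2 * e < c * r - e, 4 * (c * r - e) < e + f, 2 * (c * r - e) < g &
      (c * r - e) ^+ 2 <= e * (e + f)].
Proof.
move=> e0 ef g0 r0 temple cle cgt gap.
have f0 : 0 < f by lra.
have s0 : 0 < Num.sqrt (e / f) by rewrite sqrtr_gt0 divr_gt0.
have ss : Num.sqrt (e / f) ^+ 2 = e / f by rewrite sqr_sqrtr// ltW// divr_gt0.
set s := Num.sqrt (e / f) in s0 ss cgt.
(* In terms of s everything is polynomial: e = f s^2 and sqrt(e f) = f s, with c r <= f s <= r. *)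
have eE : e = f * s ^+ 2 by rewrite ss mulrCA mulfV ?mulr1// gt_eqF.
have sE : Num.sqrt (e * f) = f * s.
  by rewrite eE mulrAC -expr2 -exprMn sqrtr_sqr gtr0_norm// mulr_gt0.
rewrite ler_pdivlMr// sE in cle.
have fsr : f * s <= r.
  by rewrite -sE -[r]gtr0_norm// -sqrtr_sqr ler_wsqrtr.
have crgt : 3 * e < c * r.
  rewrite (@lt_le_trans _ _ (c * (f * s)))//; last first.
    by rewrite ler_wpM2l// ltW// (lt_trans _ cgt)// mulr_gt0.
  have -> : 3 * e = 3 * s * (f * s) by rewrite eE; ring.
  by rewrite ltr_pM2r// mulr_gt0.
have G0 : 0 < e + f by lra.
have sg : 2 * s * (e + f) < g.
  rewrite -ltr_pdivlMr// -(@ltr_pXn2r _ 2)// ?nnegrE; last 2 first.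
  - by rewrite mulr_ge0// ltW.
  - by rewrite ltW// divr_gt0.
  by rewrite exprMn ss; lra.
split.
- lra.
(* As c r - e <= f s - f s^2, the bound 4 (f s - f s^2) <= f is this square times f. *)
- have : 0 <= (2 * s - 1) ^+ 2 by exact: sqr_ge0.
  nra.
- nra.
- apply: (@le_trans _ _ ((f * s) ^+ 2)).
    by rewrite lerXn2r ?nnegrE//; nra.
  nra.
Qed.

(** * Temple's inequality and the inverse iteration step *)

Section Iterate.
Context {R : realType} {n : nat} {H S : 'M[R[i]]_n}.
Context {lam : nat -> R} {u : nat -> 'cV[R[i]]_n}.
Hypothesis Spd : posdefmx S.
Hypothesis eig : eigensystem H S lam u.
Context {i : nat}.
Hypothesis i1n : (1 <= i < n)%N.
Local Notation coord x k := (((ucols u 1 n) ^t* *m S *m x) k 0).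

(** The difference of the two sides is the sum of (lambda_k - lambda_i) (lambda_k - lambda_(i+1))
    |x_k|^2. No eigenvalue lies strictly between lambda_i and lambda_(i+1), and the components
    before the i-th vanish, so each term is nonnegative. *)
Lemma temple (l : R) (x : 'cV[R[i]]_n) :
  qform S x = 1 -> qform H x = l ->
  (forall k : 'I_n, (k < i.-1)%N -> coord x k = 0) ->
  (l - lam i) * (lam i.+1 - l) <= qform (invmx S) (residual H S l x).
Proof.
move=> Sx Hx x0; rewrite (resnorm_sq Spd eig) -subr_ge0.
rewrite (_ : _ - _ = \sum_(k < n)
    (lam k.+1 - lam i) * (lam k.+1 - lam i.+1) * csq (coord x k)); last first.
  move: Sx Hx; rewrite (eig_qformA eig) (eig_qformB eig) => Sx Hx.
  under [RHS]eq_bigr => k _.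
    rewrite (_ : _ * _ * _ = (lam k.+1 - l) ^+ 2 * csq (coord x k) +
      ((2 * l - lam i - lam i.+1) * (lam k.+1 * csq (coord x k)) +
      (lam i * lam i.+1 - l ^+ 2) * csq (coord x k))); last by ring.
    over.
  rewrite !big_split/= -!mulr_sumr Sx Hx; ring.
apply: sumr_ge0 => k _; have [/x0 ->|ik] := ltnP k i.-1.
  by rewrite csqR expr0n mulr0.
have [i1 ile] := andP i1n.
rewrite mulr_ge0 ?csq_ge0//.
have [ki|ki] := leqP i k.
  rewrite mulr_ge0// subr_ge0 (eig_le eig)// ?ltn_ord ?i1//=.
  by rewrite ltnW.
have -> : k.+1 = i by move: ik ki i1; clear; lia.
by rewrite subrr mul0r.
Qed.

Context {beta : R}.
Local Notation b := (lam i - beta).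
Local Notation G := (lam i.+1 - lam i).
Hypothesis b0 : 0 < b.
Hypothesis bG : 4 * b < G.
Hypothesis bg : 2 * b < lam i - lam i.-1.

Lemma above_shift (k : 'I_n) : (i.-1 <= k)%N -> b <= lam k.+1 - beta.
Proof.
have [i1 ile] := andP i1n => ik.
rewrite lerD2r (eig_le eig)// i1/=.
by move: ik i1; clear; lia.
Qed.

Lemma far_above_shift (k : 'I_n) : (i <= k)%N -> G <= lam k.+1 - lam i.
Proof. by move=> ik; rewrite lerD2r (eig_le eig)//=. Qed.

(** With [above_shift] this keeps every eigenvalue at distance at least b from beta, whence
    invertibility and the bound on [delta]. *)
Lemma below_shift (k : 'I_n) : (k < i.-1)%N -> lam k.+1 - beta < - b.
Proof.
have [i1 ile] := andP i1n => ik.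
have : lam k.+1 <= lam i.-1.
  by rewrite (eig_le eig)//= (leq_trans (leq_pred _))// ltnW.
by move=> lk; have bg' := bg; lra.
Qed.

Lemma shift_neq (k : 'I_n) : lam k.+1 != beta.
Proof.
have b0' := b0; rewrite -subr_eq0.
have [/below_shift|/above_shift] := ltnP k i.-1 => ?.
  by rewrite lt_eqF//; lra.
by rewrite gt_eqF//; lra.
Qed.

Local Notation K := (shift_invert H S beta).

(** Because 1 - (lambda_k - l) / (lambda_k - beta) = (l - beta) / (lambda_k - beta). *)
Lemma coord_inverse_step (l : R) (x : 'cV[R[i]]_n) (k : 'I_n) :
  coord (x - K *m residual H S l x) k =
  ((l - beta) / (lam k.+1 - beta))%:C * coord x k.
Proof.
rewrite (shift_invert_udiag eig shift_neq).
have -> : residual H S l x =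
      S *m (udiag u (fun k => lam k.+1 - l) *m S *m x).
  by rewrite /residual scalemxAl -mulmxBl (shifted_udiag eig) !mulmxA.
rewrite mulmxBr mxE [X in _ + X]mxE mulmxA.
rewrite !(coord_udiag eig) mulrA -rmorphM/= -[X in X - _]mul1r -mulrBl.
have nz : lam k.+1 - beta != 0 by rewrite subr_eq0 shift_neq.
by congr (_ * _); rewrite -rmorphB/=; congr _%:C; field.
Qed.

(* Since x + p = (l - beta) K S x is an inverse iterate, the components beyond
   the i-th one are damped by b / (G + b) <= 1 / 5 relative to the i-th one. *)
Lemma inverse_step_ritz (l : R) (x : 'cV[R[i]]_n)
    (z := x - K *m residual H S l x) :
  lam i < l -> 11 * (l - lam i) < G ->
  qform S x = 1 -> qform H x = l ->
  (forall k : 'I_n, (k < i.-1)%N -> coord x k = 0) ->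
  qform H z <= (lam i + (l - lam i) / 20) * qform S z.
Proof.
have [b0' bG' bg'] := And3 b0 bG bg.
move=> il lG Sx Hx x0.
have [i1 ile] := andP i1n.
have in0 : (i.-1 < n)%N by rewrite prednK// ltnW.
(* The ordinal of u_i. *)
pose k0 := Ordinal in0.
pose w (k : 'I_n) := csq (coord x k).
have w0 k : 0 <= w k by exact: csq_ge0.
have wi (k : 'I_n) : (k < i.-1)%N -> w k = 0.
  by move=> /x0 wk; rewrite /w wk csqR expr0n.
have bk (k : 'I_n) : k != k0 -> (i.-1 <= k)%N -> (i <= k)%N.
  by rewrite -val_eqE/=; move: i1; clear; lia.
set e := l - lam i in lG *; have e0 : 0 < e by rewrite subr_gt0.
have eE : \sum_(k < n) (lam k.+1 - lam i) * w k = e.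
  under eq_bigr do rewrite mulrBl.
  rewrite sumrB -mulr_sumr -(eig_qformA eig) -(eig_qformB eig) Sx Hx.
  by rewrite mulr1.
(* The mass off u_i contributes at least G per unit to e, and e < G / 11. *)
have wk0 : 10 / 11 <= w k0.
  have : G * (1 - w k0) <= e.
    have <- : \sum_(k < n | k != k0) w k = 1 - w k0.
      rewrite -Sx (eig_qformB eig) [in RHS](bigD1 k0)//= -/(w k0).
      by rewrite addrAC subrr add0r.
    rewrite -eE [leRHS](bigD1 k0)//= prednK// subrr mul0r add0r mulr_sumr.
    rewrite ler_sum// => k kk0.
    have [/wi ->|/(bk k kk0) ik] := ltnP k i.-1; first by rewrite !mulr0.
    by rewrite ler_wpM2r ?far_above_shift.
  have G0 : 0 < G by lra.
  by rewrite leNgt => wk; apply/negP => ?; nra.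
rewrite (eig_qformA eig) (eig_qformB eig) -subr_le0 mulr_sumr -sumrB.
under eq_bigr => k _.
  rewrite -mulrBl coord_inverse_step csqM csqR -/(w k).
  rewrite expr_div_n (_ : _ * (_ * w k) = (l - beta) ^+ 2 *
    ((lam k.+1 - lam i - e / 20) / (lam k.+1 - beta) ^+ 2 * w k)); last first.
    by ring.
  over.
rewrite -mulr_sumr mulr_ge0_le0 ?sqr_ge0//.
rewrite (bigD1 k0)//= prednK// subrr add0r.
(* Here lambda_k - beta >= G + b >= 5 b. The i-th term is at most -(e / b^2) (10 / 11) / 20 = -(e /
   b^2) / 22, which outweighs (e / b^2) / 25. *)
have rest : \sum_(k < n | k != k0) (lam k.+1 - lam i - e / 20) /
    (lam k.+1 - beta) ^+ 2 * w k <= e / (25 * b ^+ 2).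
  rewrite -{2}eE [in leRHS](bigD1 k0)//= prednK// subrr mul0r add0r mulr_suml.
  rewrite ler_sum// => k kk0; rewrite [leRHS]mulrAC.
  have [/wi ->|/(bk k kk0) ik] := ltnP k i.-1; first by rewrite !mulr0.
  rewrite ler_wpM2r//.
  have Gk := far_above_shift ik; have b2 : 0 < b ^+ 2 by rewrite exprn_gt0.
  have bk2 : 25 * b ^+ 2 <= (lam k.+1 - beta) ^+ 2 by nra.
  rewrite ler_pM ?invr_ge0 ?sqr_ge0//; [lra|lra|].
  by rewrite lef_pV2// ?posrE; lra.
rewrite -lerBrDl (le_trans rest)// sub0r.
have -> : - ((- (e / 20)) / b ^+ 2 * w k0) = e / b ^+ 2 * (w k0 / 20) by ring.
rewrite invfM mulrCA mulrC ler_wpM2l ?divr_ge0 ?sqr_ge0 ?ltW//.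
lra.
Qed.

End Iterate.

(** * Bounds on delta, theta, tau and Delta; localization and rate *)

Section Rates.
Context {R : realType} {n : nat} {H S : 'M[R[i]]_n}.
Context {lam : nat -> R} {u : nat -> 'cV[R[i]]_n}.
Hypothesis Spd : posdefmx S.
Hypothesis eig : eigensystem H S lam u.
Context {i : nat} {beta : R}.
Hypothesis i1n : (1 <= i < n)%N.
Local Notation b := (lam i - beta).
Local Notation G := (lam i.+1 - lam i).
Hypothesis b0 : 0 < b.
Hypothesis bG : 4 * b < G.
Hypothesis bg : 2 * b < lam i - lam i.-1.
Local Notation K := (shift_invert H S beta).
Local Notation M := (deflM H S lam u i).

Lemma delta_le : delta S K <= b^-1.
Proof.
have b0' := b0.
rewrite /delta (shift_invert_udiag eig (shift_neq eig i1n b0 bg)).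
apply: (specnorm_udiag_le Spd eig) => [k|]; last by rewrite invr_ge0 ltW.
rewrite normfV lef_pV2 ?posrE// ?normr_gt0 ?subr_eq0
  ?(shift_neq eig i1n b0 bg)//.
have [/(below_shift eig i1n bg)|/(above_shift (beta := beta) eig i1n)] :=
  ltnP k i.-1 => h.
  by rewrite ltr0_norm; lra.
by rewrite ger0_norm; lra.
Qed.

(** The nonzero diagonal entries of K M K are x / (x + b)^2 with x = lambda_k - lambda_i >= G, and
    each is at most 1 / (x + b). *)
Lemma theta_le : theta S M K <= (G + b)^-1.
Proof.
have [b0' bG'] := conj b0 bG; have [i1 ile] := andP i1n.
rewrite /theta (shift_invert_udiag eig (shift_neq eig i1n b0 bg)).
rewrite (deflM_udiag Spd eig (ltnW ile)).
set k1 := udiag u (fun _ => _^-1); set m1 := udiag u _.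
have -> : sqrtmx S *m k1 *m (S *m m1 *m S) *m k1 *m sqrtmx S =
    sqrtmx S *m (k1 *m S *m m1 *m S *m k1) *m sqrtmx S.
  by rewrite !mulmxA.
rewrite !(udiag_mul eig); apply: (specnorm_udiag_le Spd eig) => [k|]; last first.
  by rewrite invr_ge0; lra.
have [ki|ik] := leqP i k; last first.
  rewrite (_ : _ * (lam _ - lam i) = 0) ?mulr0 ?mul0r ?normr0 ?invr_ge0;
    first lra.
  have [ik'|] := leqP i.-1 k; last by rewrite mul0r.
  rewrite (_ : k.+1 = i) ?subrr ?mulr0//.
  by move: ik ik' i1; clear; lia.
have := far_above_shift eig ki; rewrite (leq_trans (leq_pred i) ki) => Gk.
set x := lam k.+1 - lam i in Gk *.
have -> : lam k.+1 - beta = x + b by rewrite /x; ring.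
have xb : 0 < x + b by lra.
rewrite mul1r ger0_norm; last first.
  by rewrite !mulr_ge0 ?invr_ge0//; lra.
apply: (@le_trans _ _ ((x + b)^-1)).
  by rewrite -mulrA ler_piMr ?invr_ge0 ?(ltW xb)// ler_pdivrMr//; lra.
by rewrite lef_pV2 ?posrE; lra.
Qed.

(** The nonzero eigenvalues are x / (x + b) with x = lambda_k - lambda_i >= G, increasing in x. *)
Lemma pos_eigenvalues_range (a : R) : pos_eigenvalues (K *m M) a ->
  G / (G + b) <= a <= 1.
Proof.
have [b0' bG'] := conj b0 bG; have [i1 ile] := andP i1n.
rewrite (shift_invert_udiag eig (shift_neq eig i1n b0 bg)).
rewrite (deflM_udiag Spd eig (ltnW ile)) !mulmxA (udiag_mul eig).
case=> a0 /(eigenvalue_udiag eig)[k aE]; move: a0; rewrite {}aE.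
have [ki _|ik] := leqP i k; last first.
  rewrite (_ : _ * (lam _ - lam i) = 0) ?mulr0 ?ltxx//.
  have [ik'|] := leqP i.-1 k; last by rewrite mul0r.
  rewrite (_ : k.+1 = i) ?subrr ?mulr0//.
  by move: ik ik' i1; clear; lia.
have := far_above_shift eig ki; rewrite (leq_trans (leq_pred i) ki) => Gk.
set x := lam k.+1 - lam i in Gk *.
have -> : lam k.+1 - beta = x + b by rewrite /x; ring.
have xb : 0 < x + b by lra.
rewrite mul1r (mulrC _ x) ler_pdivrMr; last lra.
rewrite mulrAC ler_pdivlMr// ler_pdivrMr// mul1r.
by apply/andP; split; nra.
Qed.

Lemma pos_eigenvalues_neq0 : pos_eigenvalues (K *m M) !=set0.
Proof.
have [b0' bG'] := conj b0 bG; have [i1 ile] := andP i1n.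
rewrite (shift_invert_udiag eig (shift_neq eig i1n b0 bg)).
rewrite (deflM_udiag Spd eig (ltnW ile)) !mulmxA (udiag_mul eig).
pose d (k : 'I_n) :=
  (lam k.+1 - beta)^-1 * ((i.-1 <= k)%N%:R * (lam k.+1 - lam i)).
(* The ordinal i stands for u_(i+1), which exists because i < n. *)
exists (d (Ordinal ile)); split; last exact: (udiag_eigenvalue eig).
by rewrite /d/= leq_pred mul1r mulr_gt0 ?invr_gt0; lra.
Qed.

Lemma extreme_eigenvalues_range :
  [/\ G / (G + b) <= gam_min M K, gam_min M K <= Gam_max M K & Gam_max M K <= 1].
Proof.
have range := pos_eigenvalues_range; have [a Ka] := pos_eigenvalues_neq0.
split.
- by apply: lb_le_inf; [exists a | move=> x /range/andP[]].
- apply: (@le_trans _ _ a).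
    by apply: ge_inf => //; exists (G / (G + b)) => x /range/andP[].
  by apply: ub_le_sup => //; exists 1 => x /range/andP[].
- by apply: ge_sup; [exists a | move=> x /range/andP[]].
Qed.

Lemma tau_bounds : 0 < tau M K <= (G + b) / G.
Proof.
have [b0' bG'] := conj b0 bG.
have [gm mM M1] := extreme_eigenvalues_range; rewrite /tau.
have G0 : 0 < G by lra.
have g0 : 0 < G / (G + b) by rewrite divr_gt0//; lra.
rewrite divr_gt0/=; [|lra|lra].
rewrite ler_pdivrMr; last lra.
rewrite -ler_pdivrMl; last by rewrite divr_gt0//; lra.
rewrite invf_div; lra.
Qed.

(** The quotient is at most (1 - g) / (2 g) with g = G / (G + b), which equals b / (2 G). *)
Lemma Delta_bounds : 0 <= Delta M K <= b / (2 * G).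
Proof.
have [b0' bG'] := conj b0 bG.
have [gm mM M1] := extreme_eigenvalues_range; rewrite /Delta.
have G0 : 0 < G by lra.
have g0 : 0 < G / (G + b) by rewrite divr_gt0//; lra.
rewrite divr_ge0/=; [|lra|lra].
have -> : b / (2 * G) = (1 - G / (G + b)) / (2 * (G / (G + b))).
  by field; rewrite !gt_eqF//; lra.
rewrite ler_pdivrMr; last lra.
rewrite mulrAC ler_pdivlMr; last lra.
nra.
Qed.

Context {e : R}.
Hypothesis e0 : 0 < e.
Hypothesis eG : 11 * e < G.

Lemma tau_sqrt_theta_le :
  tau M K * Num.sqrt (theta S M K * e) <= 5 / 4 * Num.sqrt (e / G).
Proof.
have [b0' bG' e0' eG'] := And4 b0 bG e0 eG.
have /andP[t0 tG] := tau_bounds.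
have G0 : 0 < G by lra.
apply: ler_pM; rewrite ?sqrtr_ge0 ?(ltW t0)//.
  by rewrite (le_trans tG)// ler_pdivrMr//; lra.
rewrite ler_wsqrtr// mulrC ler_wpM2l ?(ltW e0')//.
by rewrite (le_trans theta_le)// lef_pV2 ?posrE; lra.
Qed.

(** The hypothesis gives b / G <= sqrt(e / G), so Delta contributes at most 1/2 and the other term
    5/4 of that root. *)
Lemma rate_bounds : b ^+ 2 <= e * G ->
  0 <= rate S M K e <= 2 * Num.sqrt (e / G).
Proof.
have [b0' bG' e0' eG'] := And4 b0 bG e0 eG.
move=> b2; have /andP[t0 _] := tau_bounds; have /andP[D0 Db] := Delta_bounds.
have G0 : 0 < G by lra.
rewrite /rate; set ts := tau M K * Num.sqrt _.
have ts0 : 0 <= ts by rewrite mulr_ge0 ?sqrtr_ge0 ?(ltW t0).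
rewrite addr_ge0//=.
have bs : b / G <= Num.sqrt (e / G).
  have bG0 : 0 < b / G by rewrite divr_gt0.
  rewrite -[leLHS]gtr0_norm// -sqrtr_sqr ler_wsqrtr//.
  rewrite expr_div_n ler_pdivrMr ?exprn_gt0//.
  by rewrite (le_trans b2)// expr2 mulrA divfK// gt_eqF.
have h1 : ts <= _ := tau_sqrt_theta_le.
have bE : b / (2 * G) = b / G / 2 by rewrite invfM; ring.
rewrite bE in Db.
have s0 : 0 <= Num.sqrt (e / G) by exact: sqrtr_ge0.
lra.
Qed.

(** The three contributions add up to less than 2/5 + 1/2 + 1/11 < 1. *)
Lemma shift_localized : 2 * e < b -> localized S M K e.
Proof.
have [b0' bG' e0' eG'] := And4 b0 bG e0 eG.
move=> eb; have /andP[t0 tG] := tau_bounds.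
have G0 : 0 < G by lra.
have h1 : tau M K * Num.sqrt (theta S M K * e) <= 2 / 5.
  apply: le_trans tau_sqrt_theta_le _.
  (* 8/25 is a rational bound for sqrt(1/11), and 5/4 * 8/25 = 2/5. *)
  rewrite -ler_pdivlMl// (_ : _ * _ = 8 / 25); last by field.
  rewrite -[leRHS]ger0_norm// -sqrtr_sqr ler_wsqrtr// ler_pdivrMr//.
  lra.
have h2 : tau M K * (delta S K * e) <= e / b + e / G.
  have -> : e / b + e / G = (G + b) / G * (b^-1 * e).
    by field; rewrite !gt_eqF.
  apply: (@le_trans _ _ (tau M K * (b^-1 * e))).
    by rewrite ler_wpM2l ?(ltW t0)// ler_wpM2r ?(ltW e0')// delta_le.
  by rewrite ler_wpM2r// mulr_ge0 ?invr_ge0 ?(ltW b0') ?(ltW e0').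
have h3 : e / b < 1 / 2 by rewrite ltr_pdivrMr//; lra.
have h4 : e / G < 1 / 11 by rewrite ltr_pdivrMr//; lra.
rewrite /localized mulrDr; lra.
Qed.

End Rates.

(* lam 0 is a free real number, constrained only when i = 1, where it is the
   number sigma < lambda_1. *)
Theorem theorem4p1 (R : realType) (n : nat) (H S : 'M[R[i]]_n)
    (lam : nat -> R) (u : nat -> 'cV[R[i]]_n) (i : nat)
    (lamj : nat -> R) (uj : nat -> 'cV[R[i]]_n) :
  let c := shift_const H S lam i lamj uj in
  let beta := fun j => lamj j - c * resnorm H S lamj uj j in
  let K := fun j => shift_invert H S (beta j) in
  let M := deflM H S lam u i in
  let eps := fun j => lamj j - lam i in
  H \is hermsymmx ->
  posdefmx S ->
  eigensystem H S lam u ->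
  (1 <= i <= n.-1)%N ->
  lam i.-1 < lam i < lam i.+1 ->
  psdid H S u i K lamj uj ->
  (forall j, 3 * Num.sqrt (err_ratio lam i (lamj j)) < c) ->
  (forall j, 0 < err_ratio lam i (lamj j)
               < Num.min (gap_ratio lam i ^+ 2 / 4) (1 / 10)) ->
  [/\ forall j, beta j < lam i /\ effectively_posdef S u i (K j),
      beta @ \oo --> lam i,
      forall j, localized S M (K j) (eps j),
      rate S M (K j) (eps j) @[j --> \oo] --> (0 : R)
    & asymptotically_optimal S M K eps].
Proof.
move=> c beta K M eps _ Spd eig /andP[i1 in1] /andP[li li'] psd cgt ratio.
have ile : (i < n)%N by move: i1 in1; clear; lia.
have i1n : (1 <= i < n)%N by rewrite i1.
have i1n' : (1 <= i <= n)%N by rewrite i1 ltnW.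
have G0 : 0 < lam i.+1 - lam i by rewrite subr_gt0.
have epsG j : 0 < eps j /\ 11 * eps j < lam i.+1 - lam i.
  apply: err_ratio_bounds => //.
  by have := ratio j; rewrite lt_min /err_ratio => /and3P[-> _ ->].
have lamE j : lamj j = lam i + eps j by rewrite /eps addrC subrK.
case: psd => orth0 norm0 ray0 step.
have S1 j : qform S (uj j) = 1.
  case: j => [|j]; last by have [] := psdid_step_normalized (step j).
  move: norm0; rewrite /mxnormA => /(congr1 (fun x => x ^+ 2)).
  rewrite expr1n sqr_sqrtr// (eig_qformB eig) sumr_ge0// => k _.
  exact: csq_ge0.
have Hl j : qform H (uj j) = lamj j.
  case: j => [|j]; last by have [] := psdid_step_normalized (step j).
  by rewrite ray0 /rayleigh S1 divr1.
have orth j (k : 'I_n) : (k < i.-1)%N ->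
    (((ucols u 1 n) ^t* *m S *m uj j) k 0) = 0.
  move=> ki; case: j => [|j].
    rewrite eig_coordE; move/colP/(_ (Ordinal ki)): orth0; rewrite [RHS]mxE => <-.
    by rewrite -!mulmxA !mxE; apply: eq_bigr => a _; rewrite !mxE.
  apply: (psdid_step_deflated eig (step j)) => //.
  have [ej _] := epsG j.+1; rewrite lamE.
  have : lam k.+1 <= lam i.
    apply: (eig_le eig); last exact: ltnW.
    by rewrite /= (leq_trans ki) ?leq_pred.
  by move=> h; lra.
have res_sq j : eps j * (lam i.+1 - lamj j) <= resnorm H S lamj uj j ^+ 2.
  rewrite /resnorm /mxnormA sqr_sqrtr; last first.
    rewrite (resnorm_sq Spd eig) sumr_ge0// => k _.
    by rewrite mulr_ge0 ?sqr_ge0 ?csq_ge0.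
  exact: (temple Spd eig i1n (S1 j) (Hl j) (orth j)).
have f0 j : 10 * eps j < lam i.+1 - lamj j.
  by have [_] := epsG j; rewrite lamE => h; lra.
(* Temple's inequality excludes a zero residual, so no quotient in [shift_const] divides by 0. *)
have res0 j : 0 < resnorm H S lamj uj j.
  rewrite lt_def {2}/resnorm sqrtr_ge0 andbT.
  apply/eqP => r0; have := res_sq j; rewrite r0 expr0n/= leNgt mulr_gt0//.
    by have [] := epsG j.
  by have := f0 j; have [ej _] := epsG j => h; lra.
have cle j : c <= Num.sqrt (eps j * (lam i.+1 - lamj j)) / resnorm H S lamj uj j.
  apply: ge_inf; last by exists j.
  exists 0 => _ [k _ <-]; rewrite divr_ge0 ?sqrtr_ge0//.
have bounds j : [/\ 2 * eps j < lam i - beta j,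
    4 * (lam i - beta j) < lam i.+1 - lam i,
    2 * (lam i - beta j) < lam i - lam i.-1 &
    (lam i - beta j) ^+ 2 <= eps j * (lam i.+1 - lam i)].
  have bE : lam i - beta j = c * resnorm H S lamj uj j - eps j.
    by rewrite /beta /eps; ring.
  have GE : lam i.+1 - lam i = eps j + (lam i.+1 - lamj j).
    by rewrite /eps; ring.
  have [ej _] := epsG j.
  rewrite bE [lam i.+1 - lam i]GE; apply: shift_bounds => //.
  - by rewrite subr_gt0.
  - exact: cgt.
  - by rewrite -GE; have := ratio j; rewrite lt_min => /and3P[].
have b0 j : 0 < lam i - beta j.
  by have [eb _ _ _] := bounds j; have [ej _] := epsG j; lra.
have contraction j : eps j.+1 <= eps j / 20.
  rewrite lerBlDl; have [_ bG bg _] := bounds j; have [ej ejG] := epsG j.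
  apply: (psdid_step_le eig i1n' (step j)).
  - by rewrite lerDl divr_ge0 ?(ltW ej).
  - move=> k ki; rewrite (coord_inverse_step eig i1n (b0 j) bg) orth//.
    by rewrite mulr0.
  - apply: (inverse_step_ritz eig i1n (b0 j) bG bg) => //; last exact: orth.
    by rewrite -subr_gt0.
have eps_geometric j : eps j <= geometric (eps 0%N) (1 / 20) j.
  elim: j => [|j IH]; first by rewrite /geometric/= expr0 mulr1.
  apply: le_trans (contraction j) _.
  by move: IH; rewrite /geometric/= exprSr => IH; lra.
pose s j := Num.sqrt (eps j / (lam i.+1 - lam i)).
have cvg_eps : eps @ \oo --> (0 : R).
  apply: (squeeze_cvgr (f := cst 0) (h := geometric (eps 0%N) (1 / 20))).
  - by near=> j; rewrite eps_geometric andbT; have [/ltW] := epsG j.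
  - exact: cvg_cst.
  - by apply: cvg_geometric; rewrite ger0_norm; lra.
have cvg_s : s @ \oo --> (0 : R).
  have cvg_q : eps j / (lam i.+1 - lam i) @[j --> \oo] --> (0 : R).
    by rewrite -[0](mul0r (lam i.+1 - lam i)^-1); exact: cvgMr_tmp.
  rewrite -[0](@sqrtr0 R).
  exact: (cvg_comp _ _ cvg_q (@sqrt_continuous R 0)).
have loc j : localized S M (K j) (eps j).
  have [eb bG bg _] := bounds j; have [ej ejG] := epsG j.
  exact: (shift_localized Spd eig i1n (b0 j) bG bg ej ejG eb).
have cvg_rate : rate S M (K j) (eps j) @[j --> \oo] --> (0 : R).
  apply: (squeeze_cvgr (f := cst 0) (h := fun j => 2 * s j)).
  - near=> j; have [_ bG bg b2] := bounds j; have [ej ejG] := epsG j.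
    exact: (rate_bounds Spd eig i1n (b0 j) bG bg ej ejG b2).
  - exact: cvg_cst.
  - by rewrite -(mulr0 2); apply: cvgMl_tmp.
split=> //.
- move=> j; split; first by rewrite -subr_gt0.
  have [_ bG bg _] := bounds j.
  apply: (shift_invert_effective Spd eig i1n').
    exact: (shift_neq eig i1n (b0 j) bg).
  move=> k ik; rewrite -subr_gt0 (lt_le_trans (b0 j))//.
  exact: (above_shift eig i1n ik).
(* Squeeze: 0 < lam i - beta j <= sqrt(eps j * G) = s j * G with G = lam i.+1 - lam i. *)
- rewrite -[X in _ --> X]subr0.
  have -> : beta = (fun j => lam i - (lam i - beta j)).
    by apply/funext => j; ring.
  apply: cvgB; first exact: cvg_cst.
  apply: (squeeze_cvgr (f := cst 0) (h := fun j => s j * (lam i.+1 - lam i))).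
  - near=> j; rewrite ltW//=; have [_ _ _ b2] := bounds j.
    rewrite -ler_pdivrMr// /s; have d0 : 0 < (lam i - beta j) / (lam i.+1 - lam i).
      by rewrite divr_gt0.
    rewrite -[leLHS]gtr0_norm// -sqrtr_sqr ler_wsqrtr//.
    rewrite expr_div_n ler_pdivrMr ?exprn_gt0//.
    by rewrite (le_trans b2)// expr2 mulrA divfK// gt_eqF.
  - exact: cvg_cst.
  - by rewrite -(mul0r (lam i.+1 - lam i)); apply: cvgMr_tmp.
Unshelve. all: by end_near.
Qed.
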